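(* Let $\mathcal{G}=(\mathcal{V},\mathcal{E})$, $\mathcal{V}=\{1,\dots,n\}$, be an undirected graph, let $\mathcal{O}\subset SO(3)$ be open, $f_i:\mathcal{O}\to\mathbb{R}$ be $C^2$ for $i\in\mathcal{V}$, $\alpha,\gamma>0$, and let $x=(R_1,\dots,R_n)$ be a Filippov solution in $\mathcal{D}_{\mathcal{O}}$ (see context) of $\dot R_i=R_i\omega_i^\wedge$, $\omega_i=\alpha s_i-\gamma\nabla_{R_i}f_i$, $s_i:=\sum_{j\in\mathcal{N}_i}\operatorname{sgn}(e_{ij})$. Then for almost every time $t$, for each cluster $C\in\mathcal{P}_0(x(t))$, all agents $i\in C$ have a common body angular velocity $(R_i^\top\dot R_i)^\vee(t)=\bar\omega_C(t)$, and it satisfies $$|C|\,\bar\omega_C=\alpha S_C-\gamma G_C,\qquad S_C:=\sum_{i\in C}s_i,\qquad G_C:=\sum_{i\in C}\nabla_{R_i}f_i,$$ where $|C|$ denotes the number of agents in $C$.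
   Context: Geometry. The hat map sends $\xi\in\mathbb{R}^3$ to the skew-symmetric matrix $\xi^\wedge$ with $\xi^\wedge\eta=\xi\times\eta$, with inverse $(\cdot)^\vee$. $SO(3)$ carries the bi-invariant metric $\langle R\xi^\wedge,R\eta^\wedge\rangle_R=\xi^\top\eta$, with geodesic distance $d$; $d(R,Q)=\|(\log(R^\top Q))^\vee\|$ whenever $d(R,Q)<\pi$ ($\log$ the principal matrix logarithm). For a $C^2$ function $f$ on an open subset of $SO(3)$, $\nabla_R f\in\mathbb{R}^3$ is defined by $\operatorname{grad}f(R)=R(\nabla_R f)^\wedge$. Network quantities. $\mathcal{N}_i=\{j:(i,j)\in\mathcal{E}\}$; $e_{ij}:=(\log(R_i^\top R_j))^\vee$ for $(i,j)\in\mathcal{E}$; for $z\in\mathbb{R}^3$, $\operatorname{sgn}(z):=z/\|z\|$ if $z\neq0$, $\operatorname{sgn}(0):=0$. Clusters. For $x=(R_i)_i$, the zero-error subgraph is $(\mathcal{V},\{(i,j)\in\mathcal{E}:e_{ij}=0\})$; its connected components (viewed as subsets of $\mathcal{V}$) are the clusters, and they form the cluster partition $\mathcal{P}_0(x)$. Filippov solutions. Let $\mathcal{D}_{\mathcal{O}}:=\{x=(R_i)_{i\in\mathcal{V}}\in\mathcal{O}^n: d(R_i,R_j)<\pi\ \forall(i,j)\in\mathcal{E}\}$ and $h:\mathcal{D}_{\mathcal{O}}\to\mathbb{R}^{3n}$, $h(x):=(\alpha s_i-\gamma\nabla_{R_i}f_i)_{i\in\mathcal{V}}$. The Filippov map is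 $\mathcal{K}[h](x):=\bigcap_{\delta>0}\bigcap_{\nu(\mathcal{S})=0}\overline{\mathrm{co}}\,h(\mathcal{B}_\delta(x)\setminus\mathcal{S})$, where $\mathcal{B}_\delta(x)$ is the radius-$\delta$ geodesic neighborhood of $x$ in $\mathcal{D}_{\mathcal{O}}$, $\nu$ is Riemannian volume, $\mathcal{S}$ ranges over measurable $\nu$-null sets, and $\overline{\mathrm{co}}$ is the closed convex hull. A Filippov solution on $[0,T]$ is an absolutely continuous map $x:[0,T]\to\mathcal{D}_{\mathcal{O}}$ with $\bigl((R_i^\top\dot R_i)^\vee\bigr)_i\in\mathcal{K}[h](x)$ almost everywhere. *)

(* Defs.v *)
From HB Require Import structures.
From mathcomp Require Import all_boot all_order all_algebra.
From mathcomp Require Import all_classical all_reals all_analysis.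
Import Order.TTheory GRing.Theory Num.Theory.
Import numFieldNormedType.Exports.

Set Implicit Arguments.
Unset Strict Implicit.
Unset Printing Implicit Defensive.

Local Open Scope classical_set_scope.
Local Open Scope ring_scope.

Definition dotp {R : realType} (u v : 'cV[R]_3) : R := (u^T *m v) 0 0.

Definition enorm {R : realType} (u : 'cV[R]_3) : R := Num.sqrt (dotp u u).

Definition vec3 {R : realType} (a b c : R) : 'cV[R]_3 :=
  \col_(i < 3) nth 0 [:: a; b; c] i.

Definition hat {R : realType} (xi : 'cV[R]_3) : 'M[R]_3 :=
  let x := xi 0 0 in let y := xi 1 0 in let z := xi 2 0 in
  \matrix_(i < 3, j < 3) nth 0 (nth [::] [:: [:: 0;  - z;  y];
                                             [:: z;    0; - x];
                                             [:: - y;  x;   0]] i) j.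

(* Inverse of [hat] on skew-symmetric matrices, the only place it is used. *)
Definition vee {R : realType} (A : 'M[R]_3) : 'cV[R]_3 :=
  vec3 (A 2 1) (A 0 2) (A 1 0).

Definition SO3 {R : realType} : set 'M[R]_3 :=
  [set A | A^T *m A = 1%:M /\ \det A = 1].

Definition expm {R : realType} (A : 'M[R]_3) : 'M[R]_3 :=
  lim (series (fun k => (k`!%:R)^-1 *: A ^+ k) @ \oo).

(* The eigenvalues of [hat xi] are 0 and +-i|xi|, so [enorm xi < pi] is the
   requirement |Im| < pi on the spectrum of a principal logarithm.  On rotations
   of angle pi, which have no principal logarithm, the value is unspecified. *)
Definition so3_log {R : realType} (A : 'M[R]_3) : 'M[R]_3 :=
  get [set X | expm X = A /\ exists2 xi, X = hat xi & enorm xi < pi].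

(* For U, V tangent to SO(3) at A; [so3_metric A (A *m hat xi) (A *m hat eta)]
   is [dotp xi eta]. *)
Definition so3_metric {R : realType} (A U V : 'M[R]_3) : R :=
  dotp (vee (A^T *m U)) (vee (A^T *m V)).

(* Curves are C^1 on the whole line rather than on [0, 1]; every C^1 curve on
   [0, 1] extends, by geodesics. *)
Definition so3_curve {R : realType} (c : R -> 'M[R]_3) : Prop :=
  [/\ forall t, SO3 (c t), forall t, derivable c t 1 & continuous (derive1 c)].

Definition so3_length {R : realType} (c : R -> 'M[R]_3) : \bar R :=
  (\int[lebesgue_measure]_(t in `[0%R, 1%R])
     (Num.sqrt (so3_metric (c t) (derive1 c t) (derive1 c t)))%:E)%E.

(* Extended-real valued, but finite on SO(3), which is connected. *)
Definition geodist {R : realType} (P Q : 'M[R]_3) : \bar R :=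
  ereal_inf [set so3_length c |
    c in [set c | [/\ so3_curve c, c 0 = P & c 1 = Q]]].

Definition C2_on {R : realType} (U : set 'M[R]_3) (F : 'M[R]_3 -> R) : Prop :=
  [/\ forall A, U A -> differentiable F A,
      forall u A, U A -> differentiable ('D_u F) A
    & forall u v A, U A -> {for A, continuous ('D_v ('D_u F))}].

Definition so3_open {R : realType} (O : set 'M[R]_3) : Prop :=
  exists2 U, open U & O = SO3 `&` U.

(* C^2 on a relatively open part of the embedded submanifold SO(3): locally the
   restriction of a C^2 function of the ambient matrix space. *)
Definition so3_C2 {R : realType} (O : set 'M[R]_3) (f : 'M[R]_3 -> R) : Prop :=
  forall A, O A -> exists U F,
    [/\ open U, U A, C2_on U F & forall B, O B -> U B -> f B = F B].

(* The vector g such that A (hat g) is the Riemannian gradient of f at A. *)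
Definition nabla {R : realType} (f : 'M[R]_3 -> R) (A : 'M[R]_3) : 'cV[R]_3 :=
  get [set g | forall xi : 'cV[R]_3,
    is_derive (0 : R) 1 (fun t => f (A *m expm (t *: hat xi)))
              (so3_metric A (A *m hat g) (A *m hat xi))].

Definition so3_abs_cont {R : realType} (a b : R) (c : R -> 'M[R]_3) : Prop :=
  forall eps : R, 0 < eps -> exists2 delta : R, 0 < delta &
    forall (m : nat) (u v : nat -> R),
      (forall k, (k < m)%N -> [/\ a <= u k, u k <= v k & v k <= b]) ->
      trivIset `I_m (fun k => `]u k, v k[%classic) ->
      \sum_(k < m) (v k - u k) < delta ->
      (\sum_(k < m) geodist (c (u k)) (c (v k)) < eps%:E)%E.

(* The product Borel sigma-algebra; by second countability, the Borel
   sigma-algebra of the product. *)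
Definition config_measurable {R : realType} (n : nat) :
    set (set ('I_n -> 'M[R]_3)) :=
  <<s [set S | exists i (U : set 'M[R]_3), open U /\ S = [set y | U (y i)]] >>.

Definition vol_density {R : realType} (xi : 'cV[R]_3) : R :=
  let E := fun eta : 'cV[R]_3 => expm (hat eta) in
  Num.sqrt (\det (\matrix_(a < 3, b < 3)
    so3_metric (E xi) ('D_(delta_mx a 0) E xi) ('D_(delta_mx b 0) E xi))).

Definition fcons {T : Type} (n : nat) (a : T) (v : 'I_n -> T) : 'I_n.+1 -> T :=
  fun i => oapp v a (unlift ord0 i).

(* Integration over (R^3)^n, as an iterated integral. *)
Fixpoint iter_integral {R : realType} (n : nat) :
    (('I_n -> 'cV[R]_3) -> \bar R) -> \bar R :=
  match n return (('I_n -> 'cV[R]_3) -> \bar R) -> \bar R with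
  | 0 => fun F => F (fun=> 0)
  | _.+1 => fun F =>
      (\int[lebesgue_measure]_a \int[lebesgue_measure]_b
       \int[lebesgue_measure]_c
         iter_integral (fun v => F (fcons (vec3 a b c) v)))%E
  end.

(* Volume of the product metric on SO(3)^n, read in the coordinates
   xi |-> (exp (hat xi_i))_i, |xi_i| < pi.  This chart misses only the
   configurations in which some rotation has angle pi, which have volume 0.
   The Gram determinant of the product metric is the product over i. *)
Definition riem_vol {R : realType} (n : nat) (S : set ('I_n -> 'M[R]_3)) :
    \bar R :=
  iter_integral (fun xi : 'I_n -> 'cV[R]_3 =>
    (\1_[set xi | (forall i, enorm (xi i) < pi) /\
                  S (fun i => expm (hat (xi i)))] xi
     * \prod_(i < n) vol_density (xi i))%:E).

Definition closed_convex_hull {R : realType} (m n : nat)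
    (A : set 'M[R]_(m, n)) : set 'M[R]_(m, n) :=
  smallest (fun C : set 'M[R]_(m, n) =>
    closed C /\ @convex_set R 'M[R]_(m, n) C) A.

Definition sgn {R : realType} (z : 'cV[R]_3) : 'cV[R]_3 :=
  if z == 0 then 0 else (enorm z)^-1 *: z.

Definition err {R : realType} (n : nat) (x : 'I_n -> 'M[R]_3) (i j : 'I_n) :
    'cV[R]_3 :=
  vee (so3_log ((x i)^T *m x j)).

Definition coupling {R : realType} (n : nat) (E : rel 'I_n)
    (x : 'I_n -> 'M[R]_3) (i : 'I_n) : 'cV[R]_3 :=
  \sum_(j | E i j) sgn (err x i j).

Definition clusters {R : realType} (n : nat) (E : rel 'I_n)
    (x : 'I_n -> 'M[R]_3) : {set {set 'I_n}} :=
  equivalence_partition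
    (connect [rel i j | E i j && (err x i j == 0)]) [set: 'I_n].

Definition domain {R : realType} (n : nat) (E : rel 'I_n) (O : set 'M[R]_3) :
    set ('I_n -> 'M[R]_3) :=
  [set x | (forall i, O (x i)) /\
           forall i j, E i j -> (geodist (x i) (x j) < (pi : R)%:E)%E].

(* Geodesic ball for the product metric, whose squared distance is the sum of
   the squared distances of the components. *)
Definition geoball {R : realType} (n : nat) (E : rel 'I_n) (O : set 'M[R]_3)
    (x : 'I_n -> 'M[R]_3) (delta : R) : set ('I_n -> 'M[R]_3) :=
  [set y | domain E O y /\
           (\sum_(i < n) geodist (x i) (y i) ^+ 2 < (delta ^+ 2)%:E)%E].

(* R^{3n} is 'M_(3, n), one column per agent. *)
Definition control {R : realType} (n : nat) (E : rel 'I_n)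
    (f : 'I_n -> 'M[R]_3 -> R) (alpha gamma : R) (x : 'I_n -> 'M[R]_3) :
    'M[R]_(3, n) :=
  \matrix_(k < 3, i < n)
    (alpha *: coupling E x i - gamma *: nabla (f i) (x i)) k 0.

Definition filippov {R : realType} (n : nat) (E : rel 'I_n) (O : set 'M[R]_3)
    (h : ('I_n -> 'M[R]_3) -> 'M[R]_(3, n)) (x : 'I_n -> 'M[R]_3) :
    set 'M[R]_(3, n) :=
  \bigcap_(delta in [set delta : R | 0 < delta])
    \bigcap_(S in [set S | config_measurable S /\ riem_vol S = 0%E])
      closed_convex_hull (h @` (geoball E O x delta `\` S)).

Definition body_velocity {R : realType} (c : R -> 'M[R]_3) (t : R) :
    'cV[R]_3 :=
  vee ((c t)^T *m derive1 c t).

(* The differential inclusion at time t includes the existence of the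
   derivatives; the values of x outside [0, T] play no role. *)
Definition filippov_solution {R : realType} (n : nat) (E : rel 'I_n)
    (O : set 'M[R]_3) (h : ('I_n -> 'M[R]_3) -> 'M[R]_(3, n)) (T : R)
    (x : R -> 'I_n -> 'M[R]_3) : Prop :=
  [/\ forall t, 0 <= t <= T -> domain E O (x t),
      forall i, so3_abs_cont 0 T (fun t => x t i)
    & {ae lebesgue_measure, forall t, 0 <= t <= T ->
        (forall i, derivable (fun s => x s i) t 1) /\
        filippov E O h (x t)
          (\matrix_(k < 3, i < n) body_velocity (fun s => x s i) t k 0)}].

(* Main.v *)
Require Import Defs.
From mathcomp Require Import all_boot all_order all_algebra.
From mathcomp Require Import all_classical all_reals all_analysis.
From mathcomp Require Import ring lra.
Import Order.TTheory GRing.Theory Num.Theory.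
Import numFieldNormedType.Exports.
Local Open Scope classical_set_scope.
Local Open Scope ring_scope.

Set Implicit Arguments.
Unset Strict Implicit.
Unset Printing Implicit Defensive.

(** Agents of a common cluster [C] occupy the same rotation.  Two curves that are
    differentiable at an accumulation point of their coincidence set have the
    same derivative there, and isolated coincidence times are countable; so at
    almost every time all agents of [C] share one body velocity.  On the other
    side, summing the control over [C] cancels the edges inside [C] by
    antisymmetry and leaves only edges whose error is nonzero, near which [sgn]
    is continuous.  The summed control is therefore continuous at [x t], although
    the control is not, and every element of the Filippov set has that value as
    its sum over [C].

    Only [sgn (err x i j)] matters, and by Rodrigues' formula it is the
    normalized antisymmetric part of [(x i)^T *m x j]; so neither uniqueness nor
    continuity of the logarithm is needed, only its existence at distance less
    than pi. *)

(** * Rotation matrices as 3x3 arrays *)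

Lemma ord3_ind (P : 'I_3 -> Prop) : P 0 -> P 1 -> P 2 -> forall i, P i.
Proof.
move=> P0 P1 P2 [[|[|[|//]]] i3].
- by rewrite (_ : Ordinal i3 = 0) //; apply/val_inj.
- by rewrite (_ : Ordinal i3 = 1) //; apply/val_inj.
- by rewrite (_ : Ordinal i3 = 2) //; apply/val_inj.
Qed.

Lemma sum3E (V : zmodType) (F : 'I_3 -> V) : \sum_i F i = F 0 + F 1 + F 2.
Proof.
rewrite !big_ord_recl big_ord0 addr0 addrA.
by congr (F _ + F _ + F _); apply/val_inj.
Qed.

Lemma eq_mx3 (T : Type) (A B : 'M[T]_3) :
  A 0 0 = B 0 0 -> A 0 1 = B 0 1 -> A 0 2 = B 0 2 ->
  A 1 0 = B 1 0 -> A 1 1 = B 1 1 -> A 1 2 = B 1 2 ->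
  A 2 0 = B 2 0 -> A 2 1 = B 2 1 -> A 2 2 = B 2 2 -> A = B.
Proof. by move=> *; apply/matrixP; do 2! apply: ord3_ind. Qed.

Lemma eq_cv3 (T : Type) (u v : 'cV[T]_3) :
  u 0 0 = v 0 0 -> u 1 0 = v 1 0 -> u 2 0 = v 2 0 -> u = v.
Proof.
by move=> *; apply/matrixP => i j; rewrite ord1; move: i; apply: ord3_ind.
Qed.

Section so3_algebra.
Context {R : realType}.
Implicit Types (A B : 'M[R]_3) (u v xi eta : 'cV[R]_3).

Lemma mul3E (m p : nat) (A : 'M[R]_(m, 3)) (B : 'M[R]_(3, p)) i j :
  (A *m B) i j = A i 0 * B 0 j + A i 1 * B 1 j + A i 2 * B 2 j.
Proof. by rewrite mxE sum3E. Qed.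

Lemma mxtrace3E A : \tr A = A 0 0 + A 1 1 + A 2 2.
Proof. exact: sum3E. Qed.

Lemma det3E A : \det A = A 0 0 * (A 1 1 * A 2 2 - A 1 2 * A 2 1)
  - A 0 1 * (A 1 0 * A 2 2 - A 1 2 * A 2 0)
  + A 0 2 * (A 1 0 * A 2 1 - A 1 1 * A 2 0).
Proof.
(* With entries indexed by natural numbers, the lifted ordinals of the cofactor expansion compute to
   numerals, and [ring] recognizes equal entries. *)
pose a (i j : nat) := A (inord i) (inord j).
have aE (i j : 'I_3) : A i j = a i j by rewrite /a !inord_val.
have -> : A = \matrix_(i, j) a i j by apply/matrixP => i j; rewrite mxE.
rewrite !mxE (expand_det_row _ ord0) !big_ord_recl big_ord0 /cofactor.
rewrite !(expand_det_row _ ord0) !big_ord_recl !big_ord0 /cofactor !det_mx11.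
rewrite !mxE /bump /= !exprS expr0.
set b := a; ring.
Qed.

Lemma dotpE u v : dotp u v = u 0 0 * v 0 0 + u 1 0 * v 1 0 + u 2 0 * v 2 0.
Proof. by rewrite /dotp mul3E !mxE. Qed.

Lemma hatE xi :
  ((hat xi 0 0 = 0) * (hat xi 0 1 = - xi 2 0) * (hat xi 0 2 = xi 1 0) *
   (hat xi 1 0 = xi 2 0) * (hat xi 1 1 = 0) * (hat xi 1 2 = - xi 0 0) *
   (hat xi 2 0 = - xi 1 0) * (hat xi 2 1 = xi 0 0) * (hat xi 2 2 = 0))%type.
Proof. by rewrite /hat !mxE. Qed.

Lemma veeE A :
  ((vee A 0 0 = A 2 1) * (vee A 1 0 = A 0 2) * (vee A 2 0 = A 1 0))%type.
Proof. by rewrite /vee /vec3 !mxE. Qed.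

Lemma mx1_3E :
  (((1%:M : 'M[R]_3) 0 0 = 1) * ((1%:M : 'M[R]_3) 0 1 = 0) *
   ((1%:M : 'M[R]_3) 0 2 = 0) * ((1%:M : 'M[R]_3) 1 0 = 0) *
   ((1%:M : 'M[R]_3) 1 1 = 1) * ((1%:M : 'M[R]_3) 1 2 = 0) *
   ((1%:M : 'M[R]_3) 2 0 = 0) * ((1%:M : 'M[R]_3) 2 1 = 0) *
   ((1%:M : 'M[R]_3) 2 2 = 1))%type.
Proof. by rewrite !mxE. Qed.

Lemma hatK : cancel (@hat R) vee.
Proof. by move=> xi; apply: eq_cv3; rewrite veeE hatE. Qed.

Lemma hatZ (t : R) xi : hat (t *: xi) = t *: hat xi.
Proof. by apply: eq_mx3; rewrite [RHS]mxE !hatE ?mxE ?mulr0 ?mulrN. Qed.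

Lemma vee_skewK A : A^T = - A -> hat (vee A) = A.
Proof.
move=> /matrixP skA.
have sk i j : A j i = - A i j by have := skA i j; rewrite !mxE.
have sk0 i : A i i = 0 by have := sk i i; lra.
by apply: eq_mx3; rewrite hatE ?veeE ?sk0 // -sk.
Qed.

Lemma dotp_ge0 u : 0 <= dotp u u.
Proof. by rewrite dotpE -!expr2 !addr_ge0 ?sqr_ge0. Qed.

Lemma sqr_enorm u : enorm u ^+ 2 = dotp u u.
Proof. by rewrite sqr_sqrtr ?dotp_ge0. Qed.

Lemma enorm_ge0 u : 0 <= enorm u.
Proof. exact: sqrtr_ge0. Qed.

Lemma enorm_eq0 u : (enorm u == 0) = (u == 0).
Proof.
apply/eqP/eqP => [u0|->]; last by rewrite /enorm dotpE !mxE !mulr0 !addr0 sqrtr0.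
have : dotp u u = 0 by rewrite -sqr_enorm u0 expr0n.
rewrite dotpE => /eqP.
rewrite !paddr_eq0 -?expr2 ?addr_ge0 ?sqr_ge0 // !sqrf_eq0.
by move=> /andP[/andP[/eqP ? /eqP ?] /eqP ?]; apply: eq_cv3; rewrite [RHS]mxE.
Qed.

Lemma cauchy_schwarz u v : `|dotp u v| <= enorm u * enorm v.
Proof.
rewrite -(@ler_pXn2r _ 2) ?nnegrE ?mulr_ge0 ?enorm_ge0 //.
rewrite real_normK ?num_real // exprMn !sqr_enorm !dotpE.
have := sqr_ge0 (u 0 0 * v 1 0 - u 1 0 * v 0 0).
have := sqr_ge0 (u 0 0 * v 2 0 - u 2 0 * v 0 0).
have := sqr_ge0 (u 1 0 * v 2 0 - u 2 0 * v 1 0).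
rewrite !expr2; lra.
Qed.

(** The cofactor matrix [B] satisfies [A *m B^T = 1%:M] because the determinant is 1; multiplying by
    [A^T] on the left gives [A^T = B^T]. With these relations later polynomial identities become
    linear in the monomials, within reach of [lra]. *)
Lemma SO3_adj A : SO3 A ->
  [/\ [/\ A 0 0 = A 1 1 * A 2 2 - A 1 2 * A 2 1,
       A 0 1 = A 1 2 * A 2 0 - A 1 0 * A 2 2 &
       A 0 2 = A 1 0 * A 2 1 - A 1 1 * A 2 0],
     [/\ A 1 0 = A 0 2 * A 2 1 - A 0 1 * A 2 2,
       A 1 1 = A 0 0 * A 2 2 - A 0 2 * A 2 0 &
       A 1 2 = A 0 1 * A 2 0 - A 0 0 * A 2 1] &
     [/\ A 2 0 = A 0 1 * A 1 2 - A 0 2 * A 1 1,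
       A 2 1 = A 0 2 * A 1 0 - A 0 0 * A 1 2 &
       A 2 2 = A 0 0 * A 1 1 - A 0 1 * A 1 0]].
Proof.
move=> [AtA]; rewrite det3E => detA.
pose c (i j : 'I_3) := nth 0 (nth [::] [::
  [:: A 1 1 * A 2 2 - A 1 2 * A 2 1; A 1 2 * A 2 0 - A 1 0 * A 2 2;
      A 1 0 * A 2 1 - A 1 1 * A 2 0];
  [:: A 0 2 * A 2 1 - A 0 1 * A 2 2; A 0 0 * A 2 2 - A 0 2 * A 2 0;
      A 0 1 * A 2 0 - A 0 0 * A 2 1];
  [:: A 0 1 * A 1 2 - A 0 2 * A 1 1; A 0 2 * A 1 0 - A 0 0 * A 1 2;
      A 0 0 * A 1 1 - A 0 1 * A 1 0]] i) j.
pose B := \matrix_(i, j) c i j.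
have ABt : A *m B^T = 1%:M.
  by apply: eq_mx3; rewrite mul3E !mxE /c /= /mulrb; move: detA; lra.
have /matrixP AB : A = B.
  by apply: trmx_inj; rewrite -[LHS]mulmx1 -ABt mulmxA AtA mul1mx.
by split; split; rewrite [LHS]AB mxE.
Qed.

(* For a rotation of angle [theta] about the unit vector [u], this is
   [2 sin theta u]. *)
Definition axial A : 'cV[R]_3 := vee (A - A^T).

Lemma axialE A : ((axial A 0 0 = A 2 1 - A 1 2) *
  (axial A 1 0 = A 0 2 - A 2 0) * (axial A 2 0 = A 1 0 - A 0 1))%type.
Proof. by rewrite /axial !veeE !mxE. Qed.

Lemma axial_tr A : axial A^T = - axial A.
Proof. by apply: eq_cv3; rewrite [RHS]mxE !axialE !mxE opprB. Qed.

Lemma hat_axial A : hat (axial A) = A - A^T.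
Proof.
by apply: vee_skewK; rewrite linearB /= trmxK opprB.
Qed.

Lemma SO3_tr_mul A B : SO3 A -> SO3 B -> SO3 (A^T *m B).
Proof.
move=> [AtA dA] [BtB dB]; split; last by rewrite det_mulmx det_tr dA dB mulr1.
by rewrite trmx_mul trmxK mulmxA -[X in X *m B]mulmxA (mulmx1C AtA) mulmx1.
Qed.

Lemma SO3_1 : @SO3 R 1%:M.
Proof. by split; rewrite ?trmx1 ?mulmx1 ?det1. Qed.

Lemma SO3_mul A B : SO3 A -> SO3 B -> SO3 (A *m B).
Proof.
move=> [AtA dA] SB; rewrite -[A]trmxK; apply: SO3_tr_mul => //.
by split; rewrite ?det_tr // trmxK; exact: mulmx1C.
Qed.

Lemma SO3_cancel A B : SO3 A -> A^T *m B = 1%:M -> A = B.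
Proof.
by move=> [/mulmx1C AAt _] AB; rewrite -[LHS]mulmx1 -AB mulmxA AAt mul1mx.
Qed.

(** For angle [theta] the trace is [1 + 2 cos theta], and this reads
    [4 sin^2 = (2 + 2 cos) (2 - 2 cos)]. *)
Lemma axial_sqr A : SO3 A ->
  dotp (axial A) (axial A) = (1 + \tr A) * (3 - \tr A).
Proof.
move=> SA; have [[e00 _ _] [_ e11 _] [_ _ e22]] := SO3_adj SA.
have [/matrixP AtA _] := SA.
have := (AtA 0 0, AtA 1 1, AtA 2 2); rewrite !mul3E !mx1_3E !mxE => -[[n0 n1] n2].
rewrite dotpE !axialE mxtrace3E.
lra.
Qed.

(* Cayley-Hamilton, with the adjugate of A equal to A^T; it inverts Rodrigues'
   formula as long as [1 + \tr A] does not vanish. *)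
Lemma SO3_axial_decomp A : SO3 A -> (1 + \tr A) *: (2 *: A - 2%:M) =
  (1 + \tr A) *: hat (axial A) + hat (axial A) *m hat (axial A).
Proof.
move=> SA; have [[a00 a01 a02] [a10 a11 a12] [a20 a21 a22]] := SO3_adj SA.
have [/matrixP AtA _] := SA.
have /matrixP AAt : A *m A^T = 1%:M by apply: mulmx1C; case: SA.
have := (AtA 0 0, AtA 1 1, AtA 2 2); rewrite !mul3E !mx1_3E !mxE => -[[n0 n1] n2].
have := (AtA 0 1, AtA 0 2, AtA 1 2); rewrite !mul3E !mx1_3E !mxE => -[[n3 n4] n5].
have := (AAt 0 0, AAt 1 1, AAt 2 2); rewrite !mul3E !mx1_3E !mxE => -[[m0 m1] m2].
have := (AAt 0 1, AAt 0 2, AAt 1 2); rewrite !mul3E !mx1_3E !mxE => -[[m3 m4] m5].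
rewrite hat_axial mxtrace3E.
apply: eq_mx3; rewrite ?(mul3E, mxE) /=.
all: lra.
Qed.

(** The axis [xi] is not normalized: the rotation by [theta] about it has [s = sin theta / |xi|] and
    [c = (1 - cos theta) / |xi|^2]. *)
Definition rodrigues (s c : R) xi : 'M[R]_3 :=
  1%:M + s *: hat xi + c *: (hat xi *m hat xi).

Lemma axial_rodrigues s c xi : axial (rodrigues s c xi) = (2 * s) *: xi.
Proof.
by apply: eq_cv3; rewrite axialE [RHS]mxE /rodrigues ?(mul3E, mxE) /=; ring.
Qed.

(** With [K = hat xi], the product [(1 - s K + c K^2) (1 + s K + c K^2)] differs from 1 by
    [(2 c - s^2 - c^2 |xi|^2) K^2], since [K^4 = - |xi|^2 K^2]. *)
Lemma SO3_rodrigues s c xi : c * 2 = s ^+ 2 + c ^+ 2 * dotp xi xi ->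
  SO3 (rodrigues s c xi).
Proof.
move=> cs.
have rE : ((1%:M + s *: hat xi + c *: (hat xi *m hat xi))^T *m
  (1%:M + s *: hat xi + c *: (hat xi *m hat xi)) - 1%:M) =
  (c * 2 - s ^+ 2 - c ^+ 2 * dotp xi xi) *: (hat xi *m hat xi).
  by apply: eq_mx3; rewrite ?(mul3E, mxE, dotpE) /=; ring.
split.
  apply/eqP; rewrite -subr_eq0 rE cs.
  by rewrite [X in X - _ - _]addrC addrK subrr scale0r.
transitivity (1 + dotp xi xi * (c ^+ 2 * dotp xi xi + s ^+ 2 - c * 2)).
  by rewrite det3E /rodrigues dotpE ?(mul3E, mxE) /=; ring.
by rewrite cs; ring.
Qed.

End so3_algebra.

(** * The exponential and the logarithm *)

Section so3_exp.
Context {R : realType}.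
Implicit Types (A B : 'M[R]_3) (u v xi eta : 'cV[R]_3).

(** This is Cayley-Hamilton for a skew matrix. It folds every positive power of [hat xi] onto
    [hat xi] or its square, which turns the exponential series into sine and cosine series. *)
Lemma hat_cube xi :
  hat xi *m hat xi *m hat xi = - (enorm xi ^+ 2) *: hat xi.
Proof.
by rewrite sqr_enorm dotpE; apply: eq_mx3; rewrite [RHS]mxE !mul3E !hatE; ring.
Qed.

Lemma hat_odd_pow xi m :
  hat xi ^+ m.*2.+1 = (- (enorm xi ^+ 2)) ^+ m *: hat xi.
Proof.
elim: m => [|m IHm]; first by rewrite scale1r expr1.
rewrite doubleS 2!exprSr IHm -!mulrA -[hat xi * _]/(hat xi *m hat xi).
rewrite -scalerAl -[hat xi * _]/(hat xi *m _) mulmxA hat_cube.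
by rewrite scalerA -exprSr.
Qed.

Lemma hat_even_pow xi m :
  hat xi ^+ m.*2.+2 = (- (enorm xi ^+ 2)) ^+ m *: (hat xi *m hat xi).
Proof. by rewrite exprSr hat_odd_pow -scalerAl. Qed.

(** Odd powers feed only the sine series and even ones only the cosine series. Index 0 is left out:
    its term is the identity, which is no combination of [hat xi] and its square. *)
Lemma exp_coeff_hat (t : R) xi k : xi != 0 ->
  let th := enorm xi in
  (k.+1`!%:R)^-1 *: hat (t *: xi) ^+ k.+1 =
  (th^-1 * sin_coeff (t * th) k.+1) *: hat xi -
  (th ^- 2 * cos_coeff (t * th) k.+1) *: (hat xi *m hat xi).
Proof.
rewrite -enorm_eq0 => th0 th; rewrite hatZ exprZn /sin_coeff /cos_coeff /=.
rewrite -exprnP.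
have powN m : (- (th ^+ 2)) ^+ m = (-1) ^+ m * th ^+ m.*2.
  by rewrite -[- (th ^+ 2)]mulN1r exprMn -exprM mul2n.
have [m [->|->]] : exists m, k = m.*2 \/ k = m.*2.+1.
- exists k./2; have := odd_double_half k.
  case: (odd k) => <-; first by right; rewrite half_bit_double.
  by left; rewrite (half_bit_double _ false).
- rewrite hat_odd_pow /= odd_double /= doubleK !mul0r mulr0 scale0r subr0 mul1r.
  rewrite !scalerA powN exprMn; congr (_ *: _).
  set F := _ `!%:R; rewrite exprS [th ^+ _.+1]exprS -/th.
  by field; rewrite /F pnatr_eq0 -lt0n fact_gt0 th0.
- rewrite hat_even_pow /= odd_double /= uphalf_double !mul0r mulr0 scale0r sub0r mul1r.
  rewrite !scalerA powN exprMn -scaleNr; congr (_ *: _).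
  set F := _ `!%:R; rewrite !exprS ?doubleK ?expr0 -/th.
  by field; rewrite /F pnatr_eq0 -lt0n fact_gt0 th0.
Qed.

(** Rodrigues' formula. The factor [t] stays outside the norm so that the right-hand side can be
    differentiated in [t] at 0. *)
Lemma expm_hat (t : R) xi : xi != 0 -> let th := enorm xi in
  expm (hat (t *: xi)) =
  rodrigues (sin (t * th) / th) ((1 - cos (t * th)) / th ^+ 2) xi.
Proof.
move=> xi0 th; apply/cvg_lim; first exact: norm_hausdorff.
pose K := hat xi.
(* After the shift every partial sum contains the term of index 0: the identity matrix, and the
   constant 1 of the cosine series that [1 - cos] removes. *)
rewrite -(cvg_shiftn 1).
have -> : (fun n => series (fun k => (k`!%:R)^-1 *: hat (t *: xi) ^+ k) (n + 1)%N) =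
  (fun n => 1%:M + (th^-1 * series (sin_coeff (t * th)) (n + 1)%N) *: K
    + (th ^- 2 * (1 - series (cos_coeff (t * th)) (n + 1)%N)) *: (K *m K)).
  apply/funext => n; rewrite addn1; elim: n => [|n IHn].
    rewrite /series /= !big_nat1 /sin_coeff /cos_coeff /= mul0r !mul0r mulr0 scale0r.
    by rewrite !expr0 fact0 invr1 scale1r expr0z !mulr1 subrr mulr0 scale0r !addr0.
  rewrite seriesSr IHn exp_coeff_hat // !(seriesSr _ n.+1).
  rewrite -/th -/K; apply/matrixP => i j; rewrite !mxE; ring.
rewrite /rodrigues -/K; apply: cvgD; first apply: cvgD; first exact: cvg_cst.
- apply: cvgZr_tmp; rewrite [X in _ --> X]mulrC; apply: cvgM; first exact: cvg_cst.
  rewrite (cvg_shiftn 1); rewrite sin.unlock; exact: is_cvg_series_sin_coeff.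
- apply: cvgZr_tmp; rewrite [X in _ --> X]mulrC; apply: cvgM; first exact: cvg_cst.
  apply: cvgB; first exact: cvg_cst.
  rewrite (cvg_shiftn 1); rewrite cos.unlock; exact: is_cvg_series_cos_coeff.
Qed.

Lemma expm0 : expm 0 = 1%:M :> 'M[R]_3.
Proof.
apply/cvg_lim; first exact: norm_hausdorff.
rewrite -(cvg_shiftn 1).
rewrite (_ : (fun _ => _) = cst 1%:M); first exact: cvg_cst.
apply/funext => n; rewrite addn1; elim: n => [|n IHn].
  by rewrite /series /= big_nat1 expr0 fact0 invr1 scale1r.
by rewrite seriesSr IHn expr0n /= scaler0 addr0.
Qed.
End so3_exp.

Section so3_log.
Context {R : realType}.
Implicit Types (A B : 'M[R]_3) (u v xi eta : 'cV[R]_3).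

Lemma is_derive_mx (V : normedModType R) (m n : nat) (M : V -> 'M[R]_(m, n))
    (t v : V) (D : 'M[R]_(m, n)) :
  (forall i j, is_derive t v (fun s => M s i j) (D i j)) -> is_derive t v M D.
Proof.
move=> MD; have dM : derivable M t v by apply/derivable_mxP => i j.
apply: (DeriveDef dM); rewrite derive_mx //.
by apply/matrixP => i j; rewrite mxE derive_val.
Qed.

Lemma is_derive_entry (V : normedModType R) (m n : nat) (M : V -> 'M[R]_(m, n))
    (t v : V) (D : 'M[R]_(m, n)) i j :
  is_derive t v M D -> is_derive t v (fun s => M s i j) (D i j).
Proof.
move=> [dM <-]; apply: DeriveDef; first by move/derivable_mxP : dM => /(_ i j).
by rewrite derive_mx // mxE.
Qed.

Lemma dotpZ (k : R) u : dotp (k *: u) (k *: u) = k ^+ 2 * dotp u u.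
Proof. by rewrite !dotpE !mxE; ring. Qed.

Lemma enormZ (k : R) u : 0 <= k -> enorm (k *: u) = k * enorm u.
Proof. by move=> k0; rewrite /enorm dotpZ sqrtrM ?sqr_ge0 // sqrtr_sqr ger0_norm. Qed.

Lemma enormN u : enorm (- u) = enorm u.
Proof. by rewrite /enorm -scaleN1r dotpZ sqrrN expr1n mul1r. Qed.

Lemma sgnZ (k : R) u : 0 < k -> sgn (k *: u) = sgn u.
Proof.
move=> k0; rewrite /sgn scaler_eq0 gt_eqF //=; case: ifPn => // u0.
have u1 : enorm u != 0 by rewrite enorm_eq0.
by rewrite enormZ ?ltW // scalerA; congr (_ *: _); field; rewrite u1 gt_eqF.
Qed.

Lemma sgnN u : sgn (- u) = - sgn u.
Proof.
by rewrite /sgn oppr_eq0; case: ifP => _; rewrite ?oppr0 // enormN scalerN.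
Qed.

Lemma sgn_eq0 u : (sgn u == 0) = (u == 0).
Proof.
rewrite /sgn; case: ifPn => [_|u0]; first by rewrite eqxx.
by rewrite scaler_eq0 invr_eq0 enorm_eq0 (negPf u0).
Qed.

Lemma hat0 : hat 0 = 0 :> 'M[R]_3.
Proof. by have := hatZ 0 (0 : 'cV[R]_3); rewrite !scale0r. Qed.

Lemma SO3_expm xi : SO3 (expm (hat xi)).
Proof.
have [->|xi0] := eqVneq xi 0.
  by rewrite hat0 expm0; exact: SO3_1.
rewrite -[xi]scale1r expm_hat //; apply: SO3_rodrigues.
have th0 : enorm xi != 0 by rewrite enorm_eq0.
rewrite -sqr_enorm; set th := enorm xi in th0 *.
have := sin2cos2 (1 * th); set s := sin _; set c := cos _ => sc.
rewrite !exprMn (_ : s ^+ 2 = 1 - c ^+ 2); last exact: sc.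
by field.
Qed.

(** For nonzero [xi] the axial vector is [2 sin |xi| / |xi|] times [xi], a positive multiple below
    angle pi. *)
Lemma sgn_axial_expm xi : enorm xi < pi -> sgn (axial (expm (hat xi))) = sgn xi.
Proof.
have [->|xi0] := eqVneq xi 0.
  by rewrite hat0 expm0 => _; rewrite /axial trmx1 subrr -hat0 hatK.
move=> xipi; rewrite -[in LHS](scale1r xi) expm_hat // axial_rodrigues mul1r sgnZ //.
have th0 : 0 < enorm xi by rewrite lt_neqAle enorm_ge0 eq_sym enorm_eq0 xi0.
by rewrite mulr_gt0 // divr_gt0 // sin_gt0_pi // th0.
Qed.

Lemma is_derive_expm_hat xi :
  is_derive (0 : R) (1 : R) (fun t => expm (t *: hat xi)) (hat xi).
Proof.
have [->|xi0] := eqVneq xi 0.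
  by rewrite hat0; under eq_fun do rewrite scaler0; exact: is_derive_cst.
rewrite (_ : (fun _ => _) = fun t => rodrigues (sin (t * enorm xi) / enorm xi)
    ((1 - cos (t * enorm xi)) / enorm xi ^+ 2) xi); last first.
  by apply/funext => t; rewrite -hatZ expm_hat.
have th0 : enorm xi != 0 by rewrite enorm_eq0.
set th := enorm xi in th0 *.
apply: is_derive_mx => i j.
rewrite /rodrigues (_ : (fun s => _) = fun t => (1%:M : 'M[R]_3) i j
  + (th^-1 * hat xi i j) * sin (t * th)
  + (th ^- 2 * (hat xi *m hat xi) i j) * (1 - cos (t * th))); last first.
  by apply/funext => t; rewrite !mxE; ring.
have dt : is_derive (0 : R) (1 : R) (fun t : R => t * th) th.
  by apply: is_derive_eq; rewrite /GRing.scale /=; ring.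
have ds : is_derive (0 : R) (1 : R) (fun t : R => sin (t * th)) th.
  have := @is_derive1_comp R sin (fun t => t * th) 0 _ _ (is_derive_sin _) dt.
  by rewrite mul0r cos0 mul1r.
have dc : is_derive (0 : R) (1 : R) (fun t : R => cos (t * th)) 0.
  have := @is_derive1_comp R cos (fun t => t * th) 0 _ _ (is_derive_cos _) dt.
  by rewrite mul0r sin0 oppr0 mul0r.
apply: is_derive_eq.
rewrite /= ?scaler0 ?(addr0, subr0, add0r) /GRing.scale /=.
by field.
Qed.

(** The trace is [1 + 2 cos theta], so only angle pi is excluded. The logarithm is the axial vector
    rescaled to length [phi], the angle; its Rodrigues coefficients are then those of
    [SO3_axial_decomp]. *)
Lemma expm_surj A : SO3 A -> -1 < \tr A ->
  exists2 xi, enorm xi < pi & expm (hat xi) = A.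
Proof.
move=> SA trA; have := SO3_axial_decomp SA; have := axial_sqr SA.
have t1 : 0 < 1 + \tr A by lra.
have t1' : 1 + \tr A != 0 by rewrite gt_eqF.
set a := axial A => aa decA.
(* Without an axis the decomposition reduces to [(1 + \tr A) (2 A - 2) = 0], so [A] is the
   identity. *)
have [a0|a0] := eqVneq a 0.
  exists 0; first by rewrite (eqP (_ : enorm 0 == 0)) ?pi_gt0 // enorm_eq0.
  rewrite hat0 expm0; move: decA; rewrite a0 hat0 mulmx0 scaler0 addr0 => /eqP.
  rewrite scaler_eq0 (negPf t1') /= -scalemx1 -scalerBr scaler_eq0 pnatr_eq0 /=.
  by rewrite subr_eq0 => /eqP.
have na0 : 0 < enorm a by rewrite lt_neqAle enorm_ge0 eq_sym enorm_eq0 a0.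
have := sqr_enorm a; rewrite aa => na.
have t3 : 0 < 3 - \tr A.
  by rewrite -(pmulr_rgt0 _ t1) -na exprn_gt0.
pose c := (\tr A - 1) / 2.
have c1 : -1 <= c <= 1 by rewrite /c; apply/andP; split; lra.
pose phi := acos c.
have cphi : cos phi = c by exact: acosK.
have sphi : sin phi = enorm a / 2.
  rewrite sin_acos // -[RHS]ger0_norm ?divr_ge0 ?ltW // -sqrtr_sqr; congr Num.sqrt.
  by rewrite [RHS]exprMn na /c; field.
exists ((phi / enorm a) *: a).
  rewrite enormZ ?divr_ge0 ?acos_ge0 ?enorm_ge0 // divfK ?gt_eqF //.
  by apply: acos_ltpi; rewrite (andP c1).2 andbT /c; lra.
rewrite expm_hat // divfK ?gt_eqF // cphi sphi /rodrigues.
have -> : enorm a / 2 / enorm a = 2^-1 by field; rewrite gt_eqF.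
have -> : (1 - c) / enorm a ^+ 2 = (2 * (1 + \tr A))^-1.
  by rewrite na /c; field; rewrite t1' gt_eqF.
apply: (@scalerI _ _ (2 * (1 + \tr A))); first by rewrite mulf_neq0.
move: decA; move: (hat a *m hat a) => K2; move: (hat a) => K /matrixP decA.
rewrite !scalerDr !scalerA mulfV ?mulf_neq0 // scale1r.
by apply/matrixP => i j; have := decA i j; rewrite !mxE; lra.
Qed.

Lemma so3_logP A : SO3 A -> -1 < \tr A ->
  expm (hat (vee (so3_log A))) = A /\ enorm (vee (so3_log A)) < pi.
Proof.
move=> SA trA; have [xi xipi xiA] := expm_surj SA trA.
have : [set X | expm X = A /\ exists2 eta, X = hat eta & enorm eta < pi]
  (so3_log A) by apply: getPex; exists (hat xi); split => //; exists xi.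
by move=> [+ [eta etaE]]; rewrite etaE hatK.
Qed.
End so3_log.

(** * Lower bounds on the geodesic distance *)

Section so3_length_bounds.
Context {R : realType}.
Implicit Types (A B P Q : 'M[R]_3) (u v xi eta : 'cV[R]_3).

(** Both [W - F] and [W + F] are nondecreasing on the unit interval, where [W] is a primitive of
    [w]. The mean value theorem shows it from the pointwise bound alone, without integrating
    [dF]. *)
Lemma increment_le_integral (F dF w : R -> R) :
  (forall t : R, is_derive t (1 : R) F (dF t)) -> continuous w ->
  (forall t, `|dF t| <= w t) ->
  (`|F 1 - F 0|%:E <= \int[lebesgue_measure]_(t in `[0%R, 1%R]) (w t)%:E)%E.
Proof.
move=> FdF cw dFw.
(* The larger interval from -1 to 2 makes [W] differentiable from both sides at 0 and at 1. *)
pose W (x : R) : R := \int[lebesgue_measure]_(t in `[-1, x]) w t.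
have wint : lebesgue_measure.-integrable `[-1, 2] (EFin \o w).
  apply: continuous_compact_integrable; first exact: segment_compact.
  exact: continuous_subspaceT.
have dW (x : R) : -1 < x < 2 -> is_derive x (1 : R) W (w x).
  move=> /andP[x1 x2].
  have [dWx Wx] := continuous_FTC1_closed x2 wint x1 (cw x).
  by apply: (DeriveDef dWx); rewrite -derive1E.
have dW01 (x : R) : x \in `[0, 1] -> is_derive x (1 : R) W (w x).
  by rewrite in_itv /= => /andP[x0 x1]; apply: dW; apply/andP; split; lra.
have cW (x : R) : x \in `[0, 1] -> {for x, continuous W}.
  move=> /dW01 dWx; apply: differentiable_continuous.
  by apply/derivable1_diffP; exact: ex_derive.
have -> : (\int[lebesgue_measure]_(t in `[0%R, 1%R]) (w t)%:E = (W 1 - W 0)%:E)%E.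
  rewrite EFinB; apply: continuous_FTC2 => //.
  - exact: continuous_subspaceT.
  - split.
    + by move=> x x01; have [] := dW01 x (subset_itv_oo_cc x01).
    + by apply: cvg_at_right_filter; apply: cW; rewrite in_itv /= lexx ler01.
    + by apply: cvg_at_left_filter; apply: cW; rewrite in_itv /= lexx ler01.
  - move=> x x01; have := dW01 x (subset_itv_oo_cc x01).
    by move=> ?; rewrite derive1E derive_val.
have mono (s : R) : `|s| = 1 -> 0 <= (W 1 - W 0) - s * (F 1 - F 0).
  move=> s1; pose G : R -> R := W - s *: F.
  have dG (x : R) : x \in `[0, 1] -> is_derive x (1 : R) G (w x - s *: dF x).
    by move=> /dW01 dWx; apply: is_deriveB.
  have [x _] : exists2 x : R, x \in `[0, 1] & G 1 - G 0 = (w x - s *: dF x) * (1 - 0).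
    have dGo (x : R) : x \in `]0, 1[ -> is_derive x (1 : R) G (w x - s *: dF x).
      by move=> x01; apply: dG; exact: (subset_itv_oo_cc x01).
    apply: (MVT_segment ler01 dGo).
    apply: derivable_within_continuous => x x01; have := dG x x01.
    by move=> ?; exact: ex_derive.
  rewrite subr0 mulr1 => GE.
  rewrite (_ : _ - _ = w x - s * dF x); last first.
    by rewrite -[RHS]GE /G !fctE /GRing.scale /=; ring.
  by rewrite subr_ge0 (le_trans (ler_norm _)) // normrM s1 mul1r.
have := mono 1 (normr1 _); have := mono (-1) (normrN1 _).
by move=> m1 m2; rewrite lee_fin ler_norml; apply/andP; split; lra.
Qed.

(** Here [g] is the cosine of an angle moving at speed at most [w]. Going from angle 0 to angle pi
    would take an integral of at least pi. *)
Lemma cosine_increment (g dg w : R -> R) :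
  (forall t : R, is_derive t (1 : R) g (dg t)) -> (forall t, `|g t| <= 1) ->
  continuous w -> (forall t, 0 <= w t) ->
  (forall t, `|dg t| <= Num.sqrt (1 - g t ^+ 2) * w t) ->
  g 0 = 1 ->
  (\int[lebesgue_measure]_(t in `[0%R, 1%R]) (w t)%:E < (pi : R)%:E)%E ->
  -1 < g 1.
Proof.
move=> dgE g1 cw w0 dgw g0 Ipi; rewrite ltNge; apply/negP => g1le.
have {g1le}g1E : g 1 = -1.
  by apply/eqP; rewrite eq_le g1le /=; have := g1 1; rewrite ler_norml => /andP[].
have I0 : (0 <= \int[lebesgue_measure]_(t in `[0%R, 1%R]) (w t)%:E)%E.
  by apply: integral_ge0 => t _; rewrite lee_fin.
have [I IE] : exists I, (\int[lebesgue_measure]_(t in `[0%R, 1%R]) (w t)%:E = I%:E)%E.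
  by move: I0 Ipi; case: (integral _ _ _) => // I _ _; exists I.
move: I0 Ipi; rewrite IE lee_fin lte_fin => I0 Ipi.
(* asin o g need not be differentiable where |g| = 1, but asin o (r g) is. *)
pose m := (I + pi) / 4; pose r := sin m.
have m0 : 0 < m by rewrite /m; lra.
have mpi : m < pi / 2 by rewrite /m; lra.
have r0 : 0 < r by apply: sin_gt0_pi; rewrite m0 /=; lra.
have asinr : asin r = m by apply: sinK; rewrite in_itv /=; apply/andP; split; lra.
have asinNr : asin (- r) = - m.
  by rewrite /r -sinN; apply: sinK; rewrite in_itv /=; apply/andP; split; lra.
have r1 : r < 1.
  have cm : 0 < cos m by apply: cos_gt0_pihalf; apply/andP; split; lra.
  have := sin2cos2 m; rewrite -/r => rc; rewrite -(@ltr_pXn2r _ 2) ?nnegrE ?ltW //.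
  by rewrite expr1n rc ltrBlDr ltrDl exprn_gt0.
have rg t : -1 < r * g t < 1.
  have : `|r * g t| < 1.
    rewrite normrM gtr0_norm //; apply: le_lt_trans r1.
    by rewrite ler_piMr // ltW.
  by rewrite ltr_norml.
have := @increment_le_integral (fun t => asin (r * g t))
  (fun t => (Num.sqrt (1 - (r * g t) ^+ 2))^-1 * (r * dg t)) w.
rewrite IE g1E g0 mulr1 mulrN1 asinr asinNr lee_fin => /(_ _ cw _) H.
(* The arcsine of [r * g t] goes from [m] to [- m], while [2 m = (I + pi) / 2] exceeds [I]: this is
   the contradiction. *)
have : `|- m - m| <= I.
  apply: H => t.
  have q0 : 0 < Num.sqrt (1 - (r * g t) ^+ 2).
    rewrite sqrtr_gt0 subr_gt0 -real_normK ?num_real // expr_lt1 //.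
    by rewrite ltr_norml.
  rewrite normrM normfV (gtr0_norm q0) ler_pdivrMl // normrM (gtr0_norm r0).
  (* Since [r^2 <= 1], shrinking [g] by [r] keeps the angular speed below [w]. *)
  have : r * Num.sqrt (1 - g t ^+ 2) <= Num.sqrt (1 - (r * g t) ^+ 2).
    have -> : r * Num.sqrt (1 - g t ^+ 2) = Num.sqrt (r ^+ 2 * (1 - g t ^+ 2)).
      by rewrite sqrtrM ?sqr_ge0 // sqrtr_sqr gtr0_norm.
    apply: ler_wsqrtr; rewrite mulrBr exprMn mulr1 lerD2r expr_le1 ?ltW //.
  move=> rq; apply: le_trans (ler_wpM2r (w0 t) rq).
  by rewrite -mulrA; apply: ler_wpM2l; [exact: ltW|exact: dgw].
rewrite ler_norml => /andP[+ _]; rewrite /m; lra.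
Qed.

(** Each entry of [(c s)^T *m c s] is constant; its derivative is computed once as 0 and once by the
    product rule. *)
Lemma skew_tr_mul_deriv (c : R -> 'M[R]_3) t : (forall s, SO3 (c s)) ->
  derivable c t 1 ->
  ((c t)^T *m derive1 c t)^T = - ((c t)^T *m derive1 c t).
Proof.
move=> Sc dc; have dcij i j :
    is_derive t (1 : R) (fun s => c s i j) (derive1 c t i j).
  by apply: is_derive_entry; apply: (DeriveDef dc); rewrite derive1E.
apply/matrixP => i j; rewrite [LHS]mxE [RHS]mxE !mul3E !mxE.
have : is_derive t (1 : R) (fun s => c s 0 i * c s 0 j + c s 1 i * c s 1 j
    + c s 2 i * c s 2 j) 0.
  rewrite (_ : (fun _ => _) = cst ((1%:M : 'M[R]_3) i j)); first exact: is_derive_cst.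
  by apply/funext => s; have [<- _] := Sc s; rewrite mul3E !mxE.
have : is_derive t (1 : R) (fun s => c s 0 i * c s 0 j + c s 1 i * c s 1 j
    + c s 2 i * c s 2 j)
    (c t 0 i * derive1 c t 0 j + c t 0 j * derive1 c t 0 i
     + (c t 1 i * derive1 c t 1 j + c t 1 j * derive1 c t 1 i)
     + (c t 2 i * derive1 c t 2 j + c t 2 j * derive1 c t 2 i)).
  by apply: is_deriveD; first apply: is_deriveD; apply: is_deriveM.
by move=> [_ dE] [_]; rewrite dE; lra.
Qed.

Lemma curve_derivE (c : R -> 'M[R]_3) t : (forall s, SO3 (c s)) ->
  derivable c t 1 ->
  derive1 c t = c t *m hat (vee ((c t)^T *m derive1 c t)).
Proof.
move=> Sc dc; rewrite vee_skewK; last exact: skew_tr_mul_deriv.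
by rewrite mulmxA (mulmx1C (Sc t).1) mul1mx.
Qed.

Lemma continuous_speed (c : R -> 'M[R]_3) : so3_curve c ->
  continuous (fun t => Num.sqrt (so3_metric (c t) (derive1 c t) (derive1 c t))).
Proof.
move=> [_ dc cc] t.
have cE i j : {for t, continuous (fun s => c s i j)}.
  apply: (@continuous_comp _ _ _ c (fun M : 'M[R]_3 => M i j)).
    by apply: differentiable_continuous; exact/derivable1_diffP.
  exact: coord_continuous.
have dcE i j : {for t, continuous (fun s => derive1 c s i j)}.
  by apply: (@continuous_comp _ _ _ (derive1 c) (fun M : 'M[R]_3 => M i j));
    [exact: cc|exact: coord_continuous].
have ccE i j : {for t, continuous (fun s => ((c s)^T *m derive1 c s) i j)}.
  rewrite (_ : (fun s => _) = fun s => c s 0 i * derive1 c s 0 j +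
    c s 1 i * derive1 c s 1 j + c s 2 i * derive1 c s 2 j).
    by apply: cvgD; first apply: cvgD; apply: cvgM; (apply: cE || apply: dcE).
  by apply/funext => s; rewrite mul3E !mxE.
apply: (@continuous_comp _ _ _
  (fun s => so3_metric (c s) (derive1 c s) (derive1 c s)) Num.sqrt);
  last exact: sqrt_continuous.
rewrite (_ : (fun s => _) = fun s => let B := (c s)^T *m derive1 c s in
  B 2 1 * B 2 1 + B 0 2 * B 0 2 + B 1 0 * B 1 0).
  by apply: cvgD; first apply: cvgD; apply: cvgM; apply: ccE.
by apply/funext => s; rewrite /so3_metric dotpE !veeE.
Qed.

Lemma mxtrace_mul_hat A u : \tr (A *m hat u) = - dotp (axial A) u.
Proof. by rewrite mxtrace3E !mul3E !hatE dotpE !axialE; ring. Qed.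

(* The cosine of the angle of the rotation A. *)
Definition cosine A : R := (\tr A - 1) / 2.

Lemma axial_enorm A : SO3 A -> enorm (axial A) = 2 * Num.sqrt (1 - cosine A ^+ 2).
Proof.
move=> SA; rewrite /enorm axial_sqr //.
rewrite -[2]ger0_norm // -sqrtr_sqr -sqrtrM ?sqr_ge0 //; congr Num.sqrt.
by rewrite /cosine; field.
Qed.

Lemma cosine_itv A : SO3 A -> `|cosine A| <= 1.
Proof.
move=> SA; rewrite -(@expr_le1 _ 2) // real_normK ?num_real // -subr_ge0.
have := dotp_ge0 (axial A); rewrite axial_sqr // /cosine.
set t := \tr A => t3; rewrite (_ : _ - _ = (1 + t) * (3 - t) / 4); last by field.
by rewrite divr_ge0.
Qed.

(** Take a curve from [P] to [Q] shorter than [e], and let [g] be the cosine of the angle of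
    [P^T *m c t]. Cauchy-Schwarz between axial vector and body velocity gives
    [|g'| <= sqrt (1 - g^2) w]. The crude consequence [1 - cos theta < e] controls entries of nearby
    rotations; the sharp one, angle below pi, provides a logarithm. *)
Lemma geodist_lt P Q (e : R) : (geodist P Q < e%:E)%E ->
  [/\ SO3 P, SO3 Q, (3 - \tr (P^T *m Q)) / 2 < e &
      e <= pi -> -1 < \tr (P^T *m Q)].
Proof.
move=> /ereal_inf_lt[_ [c [cc cP cQ] <-]]; rewrite /so3_length.
have [Sc dc _] := cc; have cw := continuous_speed cc.
set w : R -> R := (fun t => Num.sqrt _) in cw *.
have SP : SO3 P by rewrite -cP.
have SQ : SO3 Q by rewrite -cQ.
pose g t := cosine (P^T *m c t).
pose dg t := \tr (P^T *m derive1 c t) / 2.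
have w0 t : 0 <= w t by exact: sqrtr_ge0.
have dgE (t : R) : is_derive t (1 : R) g (dg t).
  have dcij i j : is_derive t (1 : R) (fun s => c s i j) (derive1 c t i j).
    by apply: is_derive_entry; apply: (DeriveDef (dc t)); rewrite derive1E.
  have gE : g = fun s => 2^-1 *
    ((P 0 0 * c s 0 0 + P 1 0 * c s 1 0 + P 2 0 * c s 2 0) +
     (P 0 1 * c s 0 1 + P 1 1 * c s 1 1 + P 2 1 * c s 2 1) +
     (P 0 2 * c s 0 2 + P 1 2 * c s 1 2 + P 2 2 * c s 2 2) - 1).
    by apply/funext => s; rewrite /g /cosine mxtrace3E !mul3E !mxE mulrC.
  rewrite gE; apply: is_derive_eq.
  by rewrite /dg mxtrace3E !mul3E !mxE /GRing.scale /=; field.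
have g1 t : `|g t| <= 1 by apply: cosine_itv; exact: SO3_tr_mul.
have dgw t : `|dg t| <= Num.sqrt (1 - g t ^+ 2) * w t.
  rewrite /dg curve_derivE // mulmxA mxtrace_mul_hat mulNr normrN normrM.
  rewrite normfV [`|2|]ger0_norm // ler_pdivrMr //.
  apply: (le_trans (cauchy_schwarz _ _)).
  by rewrite axial_enorm; [rewrite [leRHS]mulrC mulrA|exact: SO3_tr_mul].
have g0 : g 0 = 1.
  rewrite /g cP /cosine (_ : P^T *m P = 1%:M); last by case: SP.
  by rewrite mxtrace1; field.
have g1E : g 1 = (\tr (P^T *m Q) - 1) / 2 by rewrite /g cQ.
move=> le; split => //.
  have : (`|g 1 - g 0|%:E <= \int[lebesgue_measure]_(t in `[0%R, 1%R]) (w t)%:E)%E.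
    apply: (increment_le_integral dgE cw) => t; apply: (le_trans (dgw t)).
    rewrite ler_piMl // -[leRHS]sqrtr1 ler_wsqrtr // lerBlDr lerDl sqr_ge0 //.
  move=> /le_lt_trans /(_ le); rewrite lte_fin; apply: le_lt_trans.
  by rewrite distrC; apply: le_trans (ler_norm _); rewrite g0 g1E; lra.
move=> epi; have := cosine_increment dgE g1 cw w0 dgw g0.
rewrite g1E => /(_ (lt_le_trans le _)) tr1.
suff : -1 < (\tr (P^T *m Q) - 1) / 2 by lra.
by apply: tr1; rewrite lee_fin.
Qed.
End so3_length_bounds.

(** * Gradients *)

Section so3_gradient.
Context {R : realType}.
Implicit Types (A B P Q : 'M[R]_3) (u v xi eta : 'cV[R]_3).

Lemma hat_delta_sum xi : hat xi = \sum_k xi k 0 *: hat (delta_mx k 0).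
Proof.
by rewrite sum3E; apply: eq_mx3; rewrite ?(hatE, mxE) /=; ring.
Qed.

Lemma so3_metric_hat A u v : SO3 A -> so3_metric A (A *m hat u) (A *m hat v) = dotp u v.
Proof. by case=> AtA _; rewrite /so3_metric !mulmxA AtA !mul1mx !hatK. Qed.

Lemma is_derive_rotation A xi :
  is_derive (0 : R) (1 : R) (fun t => A *m expm (t *: hat xi)) (A *m hat xi).
Proof.
apply: is_derive_mx => i j.
rewrite mul3E (_ : (fun s => _) = fun s =>
  A i 0 * expm (s *: hat xi) 0 j + A i 1 * expm (s *: hat xi) 1 j
  + A i 2 * expm (s *: hat xi) 2 j); last by apply/funext => s; rewrite mul3E.
have de k l : is_derive (0 : R) (1 : R) (fun s => expm (s *: hat xi) k l) (hat xi k l).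
  by apply: is_derive_entry; exact: is_derive_expm_hat.
exact: is_deriveD.
Qed.

Lemma is_derive_along_rotation (F : 'M[R]_3 -> R) A xi :
  differentiable F A ->
  is_derive (0 : R) (1 : R) (fun t => F (A *m expm (t *: hat xi)))
    ('d F A (A *m hat xi)).
Proof.
move=> dF; pose c (t : R) := A *m expm (t *: hat xi).
have c0 : c 0 = A by rewrite /c scale0r expm0 mulmx1.
have dc := is_derive_rotation A xi.
have dc0 : differentiable c 0 by apply/derivable1_diffP; exact: ex_derive.
have dFc : differentiable F (c 0) by rewrite c0.
have dFcomp : differentiable (F \o c) 0 by exact: differentiable_comp.
rewrite -[fun t => _]/(F \o c).
apply: DeriveDef; first exact/derivable1_diffP.
rewrite deriveE // diff_comp // /comp c0; congr ('d F A _).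
by rewrite -deriveE // derive_val.
Qed.

(** The vector [g0] represents the linear form sending [xi] to ['d F A (A *m hat xi)], so it is a
    gradient. Whichever gradient [get] selects has the same products with the basis vectors, hence
    equals [g0]. *)
Lemma nablaE (O U : set 'M[R]_3) (f F : 'M[R]_3 -> R) A :
  so3_open O -> open U -> (forall B, O B -> U B -> f B = F B) ->
  O A -> U A -> differentiable F A ->
  nabla f A = \col_k 'd F A (A *m hat (delta_mx k 0)).
Proof.
move=> [V oV OE] oU fF OA UA dF; set g0 := \col_k _.
have [SA VA] : SO3 A /\ V A by move: OA; rewrite OE.
have lin xi : 'd F A (A *m hat xi) = dotp g0 xi.
  rewrite dotpE hat_delta_sum mulmx_sumr linear_sum sum3E !mxE.
  by rewrite -!scalemxAr !linearZ /= /GRing.scale /=; ring.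
have grad xi : is_derive (0 : R) (1 : R) (fun t => f (A *m expm (t *: hat xi)))
    (dotp g0 xi).
  rewrite -lin; apply: near_eq_is_derive (is_derive_along_rotation xi dF).
  have cA : (fun t : R => A *m expm (t *: hat xi)) t @[t --> (0 : R)] --> A.
    have dc := is_derive_rotation A xi.
    rewrite -[X in _ --> X]mulmx1 -expm0 -(scale0r (hat xi)).
    have : {for 0 : R, continuous (fun t : R => A *m expm (t *: hat xi))}.
      by apply: differentiable_continuous; apply/derivable1_diffP; exact: ex_derive.
    by [].
  have : \forall t \near (0 : R), (U `&` V) (A *m expm (t *: hat xi)).
    by apply: cA; apply: open_nbhs_nbhs; split => //; exact: openI.
  (* For small [t] the rotated point stays in both open sets, so [f] may be replaced by its
     extension [F]. *)
  apply: filterS => t [Ut Vt]; rewrite fF //; rewrite OE; split => //.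
  by apply: SO3_mul => //; rewrite -hatZ; exact: SO3_expm.
have : [set g | forall xi, is_derive (0 : R) (1 : R)
   (fun t => f (A *m expm (t *: hat xi))) (so3_metric A (A *m hat g) (A *m hat xi))]
   (nabla f A).
  by apply: getPex; exists g0 => xi; rewrite so3_metric_hat.
move=> gradE.
have uniq xi : dotp (nabla f A) xi = dotp g0 xi.
  rewrite -(so3_metric_hat (nabla f A) xi SA).
  by have [_ <-] := gradE xi; have [_ <-] := grad xi.
apply/matrixP => i j; rewrite ord1; have := uniq (delta_mx i 0).
rewrite !dotpE; move: i; apply: ord3_ind; rewrite !mxE /=; lra.
Qed.

Lemma cvg_mx (T : Type) (FF : set_system T) (FFF : Filter FF) (m n : nat)
    (y : T -> 'M[R]_(m, n)) (M : 'M[R]_(m, n)) :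
  (forall i j, y s i j @[s --> FF] --> M i j) -> y s @[s --> FF] --> M.
Proof.
move=> yM A [P MP PA]; rewrite /nbhs /= /fmap /=.
have : \forall s \near FF, forall i j, P i j (y s i j).
  by apply: filter_forall => i; apply: filter_forall => j; exact: (yM i j _ (MP i j)).
by apply: filterS => s; exact: PA.
Qed.

Lemma cvg_sum (T : Type) (FF : set_system T) (FFF : Filter FF)
    (V : normedModType R) (I : Type) (r : seq I) (P : pred I)
    (h : I -> T -> V) (l : I -> V) :
  (forall i, P i -> h i s @[s --> FF] --> l i) ->
  \sum_(i <- r | P i) h i s @[s --> FF] --> \sum_(i <- r | P i) l i.
Proof.
move=> hl; elim: r => [|i r IHr].
  by rewrite big_nil; under eq_fun do rewrite big_nil; exact: cvg_cst.
rewrite big_cons; under eq_fun do rewrite big_cons.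
by case: ifP => // Pi; apply: cvgD => //; exact: hl.
Qed.

Lemma nabla_cvg (T : Type) (FF : set_system T) (FFF : Filter FF)
    (O : set 'M[R]_3) (f : 'M[R]_3 -> R) (y : T -> 'M[R]_3) A :
  so3_open O -> so3_C2 O f -> O A -> (\forall s \near FF, O (y s)) ->
  y s @[s --> FF] --> A -> nabla f (y s) @[s --> FF] --> nabla f A.
Proof.
move=> Oo C2f OA Oy yA; have [U [F [oU UA [dF ddF _] fF]]] := C2f A OA.
(* Expanding the differential in matrix coordinates leaves partial derivatives of [F], which are
   differentiable and so continuous at [A]. *)
pose G B : 'cV[R]_3 := \col_k \sum_i \sum_j
  (B *m hat (delta_mx k 0)) i j *: 'D_(delta_mx i j) F B.
have GE B : O B -> U B -> G B = nabla f B.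
  move=> OB UB; rewrite (nablaE Oo oU fF OB UB (dF _ UB)).
  apply/matrixP => k l; rewrite !mxE.
  rewrite [X in 'd F B X]matrix_sum_delta linear_sum; apply: eq_bigr => i _.
  rewrite linear_sum; apply: eq_bigr => j _.
  by rewrite linearZ /= deriveE //; exact: dF.
have yU : \forall s \near FF, U (y s) by apply: yA; exact: open_nbhs_nbhs.
rewrite -GE //.
have Gy : \forall s \near FF, G (y s) = nabla f (y s).
  by near=> s; apply: GE; [near: s|near: s].
apply: cvg_trans (near_eq_cvg Gy) _.
have cG : {for A, continuous G}.
  apply: (@cvg_mx _ (nbhs A)) => k l; rewrite mxE; under eq_fun do rewrite mxE.
  apply: (@cvg_sum _ (nbhs A)) => i _; apply: (@cvg_sum _ (nbhs A)) => j _.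
  apply: (@cvgM _ _ (nbhs A)).
    rewrite mul3E; under eq_fun do rewrite mul3E.
    by apply: cvgD; first apply: cvgD; apply: cvgMr_tmp; exact: coord_continuous.
  exact: differentiable_continuous (ddF _ _ UA).
exact: (cvg_comp _ _ yA cG).
Unshelve. all: by end_near. Qed.
End so3_gradient.

(** * Filippov inclusions and clusters *)

Lemma cvg_entry (R : realType) (T : Type) (FF : set_system T) (m n : nat)
    (y : T -> 'M[R]_(m, n)) (M : 'M[R]_(m, n)) i j :
  y s @[s --> FF] --> M -> y s i j @[s --> FF] --> M i j.
Proof.
move=> yM.
exact: (@cvg_comp _ _ _ y (fun N : 'M[R]_(m, n) => N i j) _ _ _ yM
  (@coord_continuous _ _ _ i j M)).
Qed.

Section filippov_averaging.
Context {R : realType} (n : nat) (E : rel 'I_n) (O : set 'M[R]_3).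
Implicit Types (x y : 'I_n -> 'M[R]_3).

Lemma iter_integral0 m : iter_integral (fun _ : 'I_m -> 'cV[R]_3 => 0%E) = 0%E.
Proof.
elim: m => //= m ->.
by do 2! under eq_integral do rewrite integral0; rewrite integral0.
Qed.

Lemma riem_vol0 : riem_vol (set0 : set ('I_n -> 'M[R]_3)) = 0%E.
Proof.
rewrite -[RHS](iter_integral0 n) /riem_vol; congr iter_integral.
apply/funext => xi; rewrite indicE memNset ?mul0r //.
by case.
Qed.

Lemma config_measurable0 : config_measurable (set0 : set ('I_n -> 'M[R]_3)).
Proof. by move=> A [[A0 _ _] _]. Qed.

(** The slab [|l - L w| <= e] is closed and convex because [L] is continuous and linear. *)
Lemma closed_convex_hull_le (m p : nat) (A : set 'M[R]_(m, p))
    (L : 'M[R]_(m, p) -> R) (l e : R) :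
  {morph L : v w / v + w} -> scalable_for *%R L -> continuous L ->
  (forall w, A w -> `|l - L w| <= e) ->
  forall w, closed_convex_hull A w -> `|l - L w| <= e.
Proof.
move=> LD LZ cL AL; apply: smallest_sub => //; split.
  apply: (@closed_comp _ _ (fun w => `|l - L w|)) (@closed_le R e).
  move=> w _; apply: (@continuous_comp _ _ _ (fun w => l - L w) Num.norm).
    by apply: continuousB; [exact: cst_continuous|exact: cL].
  exact: norm_continuous.
move=> v w t; rewrite !inE /= => vl wl.
have -> : L (conv t v w) = t%:num * L v + (1 - t%:num) * L w.
  by rewrite -!LZ -LD.
have t0 : 0 <= t%:num by [].
have t1 : 0 <= 1 - t%:num by rewrite subr_ge0.
rewrite (_ : l - _ = t%:num * (l - L v) + (1 - t%:num) * (l - L w)); last by ring.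
apply: (le_trans (ler_normD _ _)); rewrite !normrM (ger0_norm t0) (ger0_norm t1).
have := ler_wpM2l t0 vl; have := ler_wpM2l t1 wl; lra.
Qed.

(** Limits along this filter involve only configurations in the domain, the ones from which the
    Filippov hulls are built. *)
Definition geoball_filter x : set_system ('I_n -> 'M[R]_3) :=
  filter_from [set delta : R | 0 < delta] (geoball E O x).

Lemma geodist_ge0 (P Q : 'M[R]_3) : (0 <= geodist P Q)%E.
Proof.
apply: le_ereal_inf_tmp => _ [c _ <-]; apply: integral_ge0 => t _.
by rewrite lee_fin sqrtr_ge0.
Qed.

Lemma geoball_geodist x y i delta : 0 < delta -> geoball E O x delta y ->
  (geodist (x i) (y i) < delta%:E)%E.
Proof.
move=> d0 [_ yd]; rewrite -lte_sqr ?geodist_ge0 ?lee_fin ?ltW // -EFin_expe.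
apply: le_lt_trans yd; rewrite (bigD1 i) //= leeDl //.
by apply: sume_ge0 => j _; exact: sqre_ge0.
Qed.

Global Instance geoball_filter_filter x : Filter (geoball_filter x).
Proof.
apply: filter_from_filter; first by exists 1 => /=.
move=> d e /= d0 e0; exists (Num.min d e); first by rewrite /= lt_min d0.
have m0 : 0 < Num.min d e by rewrite lt_min d0.
move=> y [Dy ye]; split; split => //; apply: (lt_le_trans ye); rewrite lee_fin;
  by rewrite ler_pXn2r ?nnegrE ?ge_min ?lexx ?orbT // ltW.
Qed.

Lemma near_geoball_domain x : \forall y \near geoball_filter x, domain E O y.
Proof. by exists 1 => //= y []. Qed.

(** The right-hand side is the squared Frobenius norm of [P - Q]. *)
Lemma SO3_entry_dist (P Q : 'M[R]_3) i j : SO3 P -> SO3 Q ->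
  `|P i j - Q i j| ^+ 2 <= 2 * (3 - \tr (P^T *m Q)).
Proof.
move=> [/matrixP PtP _] [/matrixP QtQ _].
have := (PtP 0 0, PtP 1 1, PtP 2 2); rewrite !mul3E !mx1_3E !mxE => -[[p0 p1] p2].
have := (QtQ 0 0, QtQ 1 1, QtQ 2 2); rewrite !mul3E !mx1_3E !mxE => -[[q0 q1] q2].
rewrite real_normK ?num_real // mxtrace3E !mul3E !mxE.
have -> : 2 * (3 - (P 0 0 * Q 0 0 + P 1 0 * Q 1 0 + P 2 0 * Q 2 0 +
  (P 0 1 * Q 0 1 + P 1 1 * Q 1 1 + P 2 1 * Q 2 1) +
  (P 0 2 * Q 0 2 + P 1 2 * Q 1 2 + P 2 2 * Q 2 2))) = \sum_k \sum_l (P k l - Q k l) ^+ 2.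
  by rewrite !sum3E; lra.
rewrite (bigD1 i) //= (bigD1 j) //= -addrA lerDl addr_ge0 ?sumr_ge0 // => k _.
  exact: sqr_ge0.
by apply: sumr_ge0 => l _; exact: sqr_ge0.
Qed.

Lemma geoball_proj_cvg x i : y i @[y --> geoball_filter x] --> x i.
Proof.
apply: cvg_mx => k l; apply/cvgrPdist_lt => e e0.
(* At distance below [d] one has [3 - \tr < 2 d], so the squared entry difference is below
   [4 d = e^2]. *)
exists (e ^+ 2 / 4); first by rewrite /= divr_gt0 ?exprn_gt0.
move=> y /= ye.
have d0 : 0 < e ^+ 2 / 4 by rewrite divr_gt0 ?exprn_gt0.
have [Sx Sy tr _] := geodist_lt (geoball_geodist i d0 ye).
rewrite -(@ltr_pXn2r _ 2) ?nnegrE ?(ltW e0) //.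
by apply: (le_lt_trans (SO3_entry_dist k l Sx Sy)); lra.
Qed.

(** The empty null set and a small radius already confine the hull to the slab [|l - L w| <= e], for
    every positive [e]. Only [L \o h] has to converge, not [h]. *)
Lemma filippov_average (h : ('I_n -> 'M[R]_3) -> 'M[R]_(3, n)) x
    (L : 'M[R]_(3, n) -> R) (l : R) :
  {morph L : v w / v + w} -> scalable_for *%R L -> continuous L ->
  L (h y) @[y --> geoball_filter x] --> l ->
  forall w, filippov E O h x w -> L w = l.
Proof.
move=> LD LZ cL Lh w wF; apply/eqP; rewrite eq_sym -subr_eq0 -normr_le0.
apply/ler_addgt0Pr => e e0; rewrite add0r.
have [d d0 dL] : \forall y \near geoball_filter x, `|l - L (h y)| <= e.
  by move/cvgrPdist_le : Lh; apply.
have wH := wF d d0 set0 (conj config_measurable0 riem_vol0).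
apply: (closed_convex_hull_le LD LZ cL _ wH).
by move=> _ [y [ye _] <-]; exact: dL.
Qed.

End filippov_averaging.

(** * The control summed over a cluster *)

Section cluster_average.
Context {R : realType} (n : nat) (E : rel 'I_n) (O : set 'M[R]_3).
Context (E_sym : symmetric E) (O_open : so3_open O).
Implicit Types (x y : 'I_n -> 'M[R]_3) (C : {set 'I_n}).

Lemma domain_SO3 x i : domain E O x -> SO3 (x i).
Proof. by move: O_open => [U _ ->] [/(_ i)[]]. Qed.

Lemma errP x i j : domain E O x -> E i j ->
  expm (hat (err x i j)) = (x i)^T *m x j /\ enorm (err x i j) < pi.
Proof.
move=> Dx Eij; have [_ _ _ /(_ (lexx _)) tr] := geodist_lt (Dx.2 i j Eij).
by apply: so3_logP => //; apply: SO3_tr_mul; exact: domain_SO3.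
Qed.

Lemma sgn_err x i j : domain E O x -> E i j ->
  sgn (err x i j) = sgn (axial ((x i)^T *m x j)).
Proof. by move=> Dx /(errP Dx)[<- epi]; rewrite sgn_axial_expm. Qed.

Lemma err_eq0 x i j : domain E O x -> E i j -> err x i j = 0 -> x i = x j.
Proof.
move=> Dx Eij e0; have [+ _] := errP Dx Eij.
rewrite e0 hat0 expm0 => /esym; apply: SO3_cancel; exact: domain_SO3.
Qed.

Lemma axial_err_eq0 x i j : domain E O x -> E i j ->
  (axial ((x i)^T *m x j) == 0) = (err x i j == 0).
Proof. by move=> Dx Eij; rewrite -sgn_eq0 -sgn_err // sgn_eq0. Qed.

(** Exchanging the endpoints of the edges inside [C] turns their sum [S] into [- S], so [S]
    vanishes. *)
Lemma sum_antisym (V : lmodType R) C (phi : 'I_n -> 'I_n -> V) :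
  (forall i j, phi j i = - phi i j) ->
  \sum_(i in C) \sum_(j | E i j) phi i j =
  \sum_(i in C) \sum_(j | E i j && (j \notin C)) phi i j.
Proof.
move=> phiN; pose S := \sum_(i in C) \sum_(j | E i j && (j \in C)) phi i j.
have -> : \sum_(i in C) \sum_(j | E i j) phi i j =
    S + \sum_(i in C) \sum_(j | E i j && (j \notin C)) phi i j.
  rewrite -big_split /=; apply: eq_bigr => i _.
  by rewrite (bigID (fun j => j \in C)).
have SN : S = - S.
  rewrite {1}/S -sumrN (exchange_big_dep (mem C)) /=; last by move=> i j _ /andP[].
  apply: eq_bigr => j jC; rewrite -sumrN; apply: eq_big => [i|i _]; last exact: phiN.
  by rewrite jC andbT E_sym andbC.
have -> : S = 0; last by rewrite add0r.
have /eqP : (2%:R : R) *: S = 0 by rewrite scaler_nat mulr2n {2}SN subrr.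
by rewrite scaler_eq0 pnatr_eq0 => /eqP.
Qed.

(** The axial vector is antisymmetric on all pairs, whereas [err] is tied to it only along edges. *)
Lemma sum_coupling x C : domain E O x ->
  \sum_(i in C) coupling E x i =
  \sum_(i in C) \sum_(j | E i j && (j \notin C)) sgn (axial ((x i)^T *m x j)).
Proof.
move=> Dx; rewrite -sum_antisym; last first.
  by move=> i j; rewrite -sgnN -axial_tr trmx_mul trmxK.
by apply: eq_bigr => i _; apply: eq_bigr => j Eij; exact: sgn_err.
Qed.

(** Rotations agree along a path of zero-error edges, and a zero-error edge leaving [C] would extend
    such a path. *)
Lemma clustersP x C : domain E O x -> C \in clusters E x ->
  (exists i, i \in C) /\
  [/\ {in C &, forall i j, x i = x j} &
      forall i j, i \in C -> E i j -> j \notin C -> err x i j != 0].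
Proof.
move=> Dx /imsetP[i0 _ ->]; set e := [rel i j | _].
have CE j : (j \in [set y in [set: 'I_n]%SET | connect e i0 y]) = connect e i0 j.
  by rewrite !inE.
split; first by exists i0; rewrite CE connect0.
have xE j : connect e i0 j -> x i0 = x j.
  move=> /connectP[p + ->]; elim: p i0 {CE} => //= k p IHp i0.
  move=> /andP[/andP[Ek /eqP e0] pk].
  by rewrite (err_eq0 Dx Ek e0); exact: IHp.
split=> [i j|i j]; first by rewrite !CE => /xE <- /xE <-.
rewrite !CE => ci Eij; apply: contra => eij.
by apply: (connect_trans ci); apply: connect1; rewrite /= Eij.
Qed.

Lemma sgn_cvg (T : Type) (FF : set_system T) (FFF : Filter FF)
    (y : T -> 'cV[R]_3) (v : 'cV[R]_3) : v != 0 ->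
  y s @[s --> FF] --> v -> sgn (y s) @[s --> FF] --> sgn v.
Proof.
move=> v0 yv.
have cent k : y s k 0 @[s --> FF] --> v k 0.
  exact: cvg_entry.
have en : enorm (y s) @[s --> FF] --> enorm v.
  have yy : dotp (y s) (y s) @[s --> FF] --> dotp v v.
    rewrite dotpE; under eq_fun do rewrite dotpE.
    by apply: cvgD; first apply: cvgD; apply: cvgM; exact: cent.
  exact: (@cvg_comp _ _ _ (fun s => dotp (y s) (y s)) Num.sqrt _ _ _ yy
    (@sqrt_continuous R (dotp v v))).
have ev : enorm v != 0 by rewrite enorm_eq0.
have : (enorm (y s))^-1 *: y s @[s --> FF] --> (enorm v)^-1 *: v.
  by apply: cvgZ => //; exact: cvgV.
rewrite {2}/sgn (negPf v0).
(* The quotient formula also holds at a zero vector, where both sides are 0. *)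
rewrite (_ : (fun s => sgn (y s)) = (fun s => (enorm (y s))^-1 *: y s)) //.
apply/funext => s; rewrite /sgn; case: eqP => // ->.
by rewrite scaler0.
Qed.

(** The set [C] is a cluster of [x] and stays fixed while [y] varies; [sum_coupling] applies to any
    set of agents. The edges kept in [W] leave [C], so their axial vectors are nonzero at [x] and
    [sgn] is continuous there. *)
Lemma sum_control_cvg (f : 'I_n -> 'M[R]_3 -> R) (alpha gamma : R) x C :
  (forall i, so3_C2 O (f i)) -> domain E O x -> C \in clusters E x ->
  let V y := alpha *: (\sum_(i in C) coupling E y i)
             - gamma *: (\sum_(i in C) nabla (f i) (y i)) in
  V y @[y --> geoball_filter E O x] --> V x.
Proof.
move=> fC2 Dx xC V; have [_ [_ errC]] := clustersP Dx xC.
pose W y := alpha *: (\sum_(i in C) \sum_(j | E i j && (j \notin C))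
    sgn (axial ((y i)^T *m y j)))
  - gamma *: (\sum_(i in C) nabla (f i) (y i)).
have WV y : domain E O y -> W y = V y by move=> Dy; rewrite /V sum_coupling.
rewrite -WV //.
have nWV : \forall y \near geoball_filter E O x, W y = V y.
  by apply: filterS (near_geoball_domain E O x) => y; exact: WV.
apply: cvg_trans (near_eq_cvg nWV) _; apply: cvgB; apply: cvgZl_tmp.
  apply: cvg_sum => i iC; apply: cvg_sum => j /andP[Eij jC].
  apply: sgn_cvg; first by rewrite axial_err_eq0 // errC.
  have cxx k l : ((y i)^T *m y j) k l @[y --> geoball_filter E O x] -->
      ((x i)^T *m x j) k l.
    have cx k' l' i' : y i' k' l' @[y --> geoball_filter E O x] --> x i' k' l'.
      by apply: cvg_entry; exact: geoball_proj_cvg.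
    rewrite mul3E !mxE; under eq_fun do rewrite mul3E !mxE.
    by apply: cvgD; first apply: cvgD; apply: cvgM; exact: cx.
  apply: (@cvg_mx _ _ _ (geoball_filter_filter E O x)) => k l; rewrite ord1.
  by move: k; apply: ord3_ind; rewrite axialE; under eq_fun do rewrite axialE;
    apply: cvgB; exact: cxx.
apply: cvg_sum => i _.
apply: (@nabla_cvg _ _ _ (geoball_filter_filter E O x) O _ (fun y => y i) _
  O_open (fC2 i) (Dx.1 i)).
  by apply: filterS (near_geoball_domain E O x) => y [].
exact: geoball_proj_cvg.
Qed.

(** For each coordinate [k], [filippov_average] is applied to the linear form summing row [k] over
    the columns in [C]. *)
Lemma filippov_cluster_sum (f : 'I_n -> 'M[R]_3 -> R) (alpha gamma : R) x C w :
  (forall i, so3_C2 O (f i)) -> domain E O x -> C \in clusters E x ->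
  filippov E O (control E f alpha gamma) x w ->
  \sum_(i in C) col i w =
  alpha *: (\sum_(i in C) coupling E x i)
  - gamma *: (\sum_(i in C) nabla (f i) (x i)).
Proof.
move=> fC2 Dx xC wF; apply/matrixP => k l; rewrite ord1.
have VE y : (alpha *: (\sum_(i in C) coupling E y i)
    - gamma *: (\sum_(i in C) nabla (f i) (y i))) k 0 =
    \sum_(i in C) control E f alpha gamma y k i.
  rewrite !scaler_sumr -sumrB summxE; apply: eq_bigr => i _.
  by rewrite [RHS]mxE.
rewrite VE summxE; under eq_bigr do rewrite mxE.
apply: (filippov_average (L := fun w => \sum_(i in C) w k i) _ _ _ _ wF).
- by move=> v u; rewrite -big_split; apply: eq_bigr => i _; rewrite mxE.
- by move=> a v; rewrite /= mulr_sumr; apply: eq_bigr => i _; rewrite mxE.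
- move=> v; apply: (@cvg_sum _ _ (nbhs v)) => i _; exact: coord_continuous.
rewrite -VE; under eq_fun do rewrite -VE.
exact: cvg_entry (sum_control_cvg fC2 Dx xC).
Qed.
End cluster_average.

(** * Coincidence times of curves, and the common cluster velocity *)

(** If the derivative of [c1 - c2] were nonzero, its difference quotients would be nonzero near [t];
    they vanish at coincidence times arbitrarily close to [t]. *)
Lemma derive1_eq_limit_point (R : realType) (V : normedModType R)
    (c1 c2 : R -> V) (t : R) :
  limit_point [set s | c1 s = c2 s] t -> c1 t = c2 t ->
  derivable c1 t 1 -> derivable c2 t 1 -> derive1 c1 t = derive1 c2 t.
Proof.
move=> limt ct d1 d2; rewrite !derive1E; apply/eqP; rewrite -subr_eq0.
rewrite -deriveB //; apply/negP => /negP D0.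
have dB : derivable (c1 - c2) t 1 by exact: derivableB.
have [e /= e0 qe] := cvgr_neq0 _ (dB : _ --> 'D_1 (c1 - c2) t) D0.
have [y [yt /= cy ty]] := limt _ (nbhsx_ballx t e e0).
have /= := qe (y - t); rewrite /ball /= sub0r normrN subr_eq0 yt distrC => /(_ ty isT).
by rewrite [_%:A]mulr1 subrK !fctE ct cy !subrr scaler0 eqxx.
Qed.

Lemma ae_derive1_eq (R : realType) (V : normedModType R) (c1 c2 : R -> V) :
  {ae lebesgue_measure, forall t, c1 t = c2 t ->
    derivable c1 t 1 -> derivable c2 t 1 -> derive1 c1 t = derive1 c2 t}.
Proof.
pose Z := [set s | c1 s = c2 s].
exists (isolated Z); split.
- by apply: countable_measurable => //; exact: countable_isolated.
- exact/countable_lebesgue_measure0/countable_isolated.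
move=> t /= /not_implyP[ct /not_implyP[d1 /not_implyP[d2 d12]]].
have : closure Z t by apply: subset_closure.
(* A coincidence time is either isolated in [Z], hence in the null set, or a limit point, where the
   derivatives agree. *)
rewrite closure_isolated_limit_point => -[//|limt]; exfalso.
exact/d12/derive1_eq_limit_point.
Qed.

Theorem lemma3 (R : realType) (n : nat) (E : rel 'I_n) (E_sym : symmetric E)
  (O : set 'M[R]_3) (O_open : so3_open O)
  (f : 'I_n -> 'M[R]_3 -> R) (f_C2 : forall i, so3_C2 O (f i))
  (alpha gamma : R) (alpha_gt0 : 0 < alpha) (gamma_gt0 : 0 < gamma)
  (T : R) (x : R -> 'I_n -> 'M[R]_3)
  (x_sol : filippov_solution E O (control E f alpha gamma) T x) :
  {ae lebesgue_measure, forall t, 0 <= t <= T ->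
    forall C : {set 'I_n}, C \in clusters E (x t) ->
    exists omega : 'cV[R]_3,
      (forall i, i \in C ->
         derivable (fun s => x s i) t 1 /\
         body_velocity (fun s => x s i) t = omega) /\
      #|C|%:R *: omega =
        alpha *: (\sum_(i in C) coupling E (x t) i)
        - gamma *: (\sum_(i in C) nabla (f i) (x t i))}.
Proof.
have [Dx _ incl] := x_sol.
(* Clusters vary with time, so one null set is fixed beforehand for all of the finitely many pairs
   of agents. *)
have vel : {ae lebesgue_measure, forall t (ij : 'I_n * 'I_n), x t ij.1 = x t ij.2 ->
    derivable (fun s => x s ij.1) t 1 -> derivable (fun s => x s ij.2) t 1 ->
    derive1 (fun s => x s ij.1) t = derive1 (fun s => x s ij.2) t}.
  by apply: filter_forall => ij; exact: ae_derive1_eq.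
have aeF := ae_filter_ringOfSetsType (@lebesgue_measure R).
move: incl vel; apply: (@filterS2 _ _ aeF) => t incl vel tT C xC.
have [dx xF] := incl tT; have Dxt := Dx t tT.
have [[i0 i0C] [xE _]] := clustersP O_open Dxt xC.
have velE i : i \in C ->
    body_velocity (fun s => x s i) t = body_velocity (fun s => x s i0) t.
  move=> iC; rewrite /body_velocity (xE _ _ iC i0C).
  by rewrite (vel (i, i0) (xE _ _ iC i0C) (dx i) (dx i0)).
exists (body_velocity (fun s => x s i0) t).
split=> [i iC|]; first by split; [exact: dx|exact: velE].
rewrite -(filippov_cluster_sum E_sym O_open f_C2 Dxt xC xF).
rewrite (eq_bigr (fun _ => body_velocity (fun s => x s i0) t)).
  by rewrite sumr_const scaler_nat.
move=> i iC; rewrite -(velE i iC); apply/matrixP => k l.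
by rewrite ord1 !mxE.
Qed.
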